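(* Let $h>0$ and $\nu:\mathbb{Z}_{\ge0}\to(0,\infty)$ with $\nu(0)\ge1$; let $T$ be the largest integer with $1>h\sum_{i=0}^T\nu(i)$, and assume $T\ge1$. Define $$R=\inf_f\frac{\frac12\sum_{k=0}^{T}\nu(k)\bigl[(f(k)-f(k+1))^2+(f(k)-f(k-1))^2\bigr]}{\sum_{k=1}^{T}f(k)^2\bigl(1-h\sum_{i=0}^k\nu(i)\bigr)},$$ the infimum over all $f:\mathbb{Z}\to\mathbb{R}$ with $f(0)=0$, $f(1)\neq0$, $f(i)=0$ for $i<0$ and $f(i)=f(T)$ for $i>T$. Let $$B=\sup_{n\ge1}\Bigl(\sum_{k=n}^T\Bigl(1-h\sum_{i=0}^k\nu(i)\Bigr)\Bigr)\Bigl(\sum_{k=1}^n\frac{1}{\nu(k)+\nu(k-1)}\Bigr).$$ Then $\frac{1}{8B}\le R\le\frac{1}{2B}$.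
   Context: In the paper $h=h_{out}(G)$ is the outer vertex isoperimetric constant of a finite $d$-regular graph $G$ and $\nu$ is a volume growth bound for shells around the optimal cut set, i.e. $|\mathrm{dist}_\Sigma^{-1}(k)|\le|\Sigma|\nu(k)$ for $k\ge0$ where $\Sigma=\partial_{out}A$ for an optimal set $A$. *)

(* Defs.v *)
From mathcomp Require Import all_boot all_order all_algebra.
From mathcomp Require Import all_classical all_reals.

Set Implicit Arguments.
Unset Strict Implicit.
Unset Printing Implicit Defensive.

Import Order.TTheory GRing.Theory Num.Theory.

Local Open Scope classical_set_scope.
Local Open Scope ring_scope.

Section Defs.
Context {R : realType}.
Implicit Types (h : R) (nu : nat -> R) (T : nat) (f : int -> R).

(* Quantifying over nat loses no integers: the inequality holds at every
   negative T (empty sum), so the largest integer, when it is >= 0, is the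
   largest natural number. *)
Definition largest_cutoff h nu T : Prop :=
  1 > h * \sum_(0 <= i < T.+1) nu i /\
  forall S : nat, 1 > h * \sum_(0 <= i < S.+1) nu i -> (S <= T)%N.

Definition weight h nu (k : nat) : R := 1 - h * \sum_(0 <= i < k.+1) nu i.

Definition admissible T f : Prop :=
  [/\ f 0 = 0, f 1 != 0, forall i : int, i < 0 -> f i = 0
    & forall i : int, T%:Z < i -> f i = f T%:Z].

Definition energy nu T f : R :=
  2^-1 * \sum_(0 <= k < T.+1)
    nu k * ((f k%:Z - f (k%:Z + 1)) ^+ 2 + (f k%:Z - f (k%:Z - 1)) ^+ 2).

Definition mass h nu T f : R :=
  \sum_(1 <= k < T.+1) f k%:Z ^+ 2 * weight h nu k.

(* For h > 0, nu > 0 and T >= 1 as in [largest_cutoff], the set is nonempty and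
   bounded below by 0 (mass is > 0 since f 1 != 0), so [inf] is the true
   infimum. *)
Definition rayleigh_inf h nu T : R :=
  inf [set energy nu T f / mass h nu T f | f in [set f | admissible T f]].

(* Only finitely many terms are nonzero (the first sum is empty for n > T), so
   [sup] is the true supremum. *)
Definition muckenhoupt_sup h nu T : R :=
  sup [set (\sum_(n <= k < T.+1) weight h nu k) *
           (\sum_(1 <= k < n.+1) (nu k + nu k.-1)^-1)
      | n in [set n : nat | (1 <= n)%N]].

End Defs.

(* Main.v *)
(** With [a k = nu k + nu (k - 1)], the energy of an admissible [f] is half of
    [sum_(1 <= k <= T) a k * (f k - f (k - 1))^2], so the theorem is a discrete
    weighted Hardy inequality with Muckenhoupt's constant.  Put
    [W n = sum_(n <= k <= T) weight k] and [S n = sum_(1 <= k <= n) 1 / a k].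

    Lower bound: replacing [f] by the sum [F] of its absolute increments keeps
    the energy and does not decrease the mass.  Abel summation turns the mass
    into [sum W k * (F k^2 - F (k - 1)^2)], where [W k <= B / S k]; the bound
    [sum (F k^2 - F (k - 1)^2) / S k <= 4 * sum a k * (F k - F (k - 1))^2] then
    follows by induction once strengthened by the term [F n^2 / S n].

    Upper bound: the truncated function [k |-> S (min k n)] has energy [S n / 2]
    and mass at least [S n^2 * W n]. *)
Require Import Defs.
From mathcomp Require Import all_boot all_order all_algebra.
From mathcomp Require Import all_classical all_reals.
From mathcomp Require Import ring lra zify.

Set Implicit Arguments.
Unset Strict Implicit.
Unset Printing Implicit Defensive.

Import Order.TTheory GRing.Theory Num.Theory.

Local Open Scope ring_scope.

(** * The discrete weighted Hardy inequality *)

(** One induction step of the Hardy bound: [s], [t] are consecutive values of [S], so [(s - t)^-1]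
    is the edge weight, and [x], [y] are consecutive values of [F]. The first difference comes from
    Abel summation, the second is the change of the slack. *)
Lemma hardy_step_form (R : realFieldType) (s t x y : R) :
  0 < t -> t < s ->
  x ^+ 2 / s - y ^+ 2 / s + (x ^+ 2 / s - y ^+ 2 / t)
    <= 4 * ((x - y) ^+ 2 / (s - t)).
Proof.
move=> t_gt0 lt_ts; have s_gt0 : 0 < s by lra.
have st_gt0 : 0 < s - t by lra.
have sDt_gt0 : 0 < s + t by lra.
rewrite -subr_ge0.
(* Completing the square; the residual discriminant is [2 (s - t)^3]. *)
have -> : 4 * ((x - y) ^+ 2 / (s - t)) -
    (x ^+ 2 / s - y ^+ 2 / s + (x ^+ 2 / s - y ^+ 2 / t)) =
    (2 * t * ((s + t) * x - 2 * s * y) ^+ 2 + (s - t) ^+ 3 * y ^+ 2)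
      / (s * t * (s - t) * (s + t)).
  by field; rewrite !gt_eqF.
apply: divr_ge0; last by rewrite !mulr_ge0 // ltW.
apply: addr_ge0; apply: mulr_ge0; rewrite ?sqr_ge0 //.
  by rewrite mulr_ge0 // ltW.
by rewrite exprn_ge0 // ltW.
Qed.

Section Hardy.
Context {R : realFieldType}.
Variables (w a : nat -> R) (T : nat) (B : R).
Hypothesis w_ge0 : forall k, (k <= T)%N -> 0 <= w k.
Hypothesis a_gt0 : forall k, 0 < a k.

Let W n := \sum_(n <= k < T.+1) w k.
Let S n := \sum_(1 <= k < n.+1) (a k)^-1.

Hypothesis WS_le : forall n, (1 <= n <= T)%N -> W n * S n <= B.

Let SS n : S n.+1 = S n + (a n.+1)^-1.
Proof. by rewrite /S big_nat_recr. Qed.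

Let S_ge0 n : 0 <= S n.
Proof. by apply: sumr_ge0 => k _; rewrite invr_ge0 ltW. Qed.

Let S_gt0 n : 0 < S n.+1.
Proof. by rewrite SS ltr_wpDl ?invr_gt0. Qed.

Lemma hardy_nondecreasing (F : nat -> R) :
  F 0%N = 0 -> (forall n, F n <= F n.+1) ->
  \sum_(1 <= k < T.+1) F k ^+ 2 * w k
    <= 4 * B * \sum_(1 <= k < T.+1) a k * (F k - F k.-1) ^+ 2.
Proof.
move=> F0 Fnd.
have F_ge0 n : 0 <= F n by elim: n => [|n IH]; rewrite ?F0 // (le_trans IH).
(* [B * F n ^+ 2 / S n] is the slack that makes the induction close; at
   [n = 0] it is [0 / 0 = 0]. *)
suff key n : (n <= T)%N ->
    \sum_(1 <= k < n.+1) F k ^+ 2 * w k + W n.+1 * F n ^+ 2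
      + B * (F n ^+ 2 / S n)
    <= 4 * B * \sum_(1 <= k < n.+1) a k * (F k - F k.-1) ^+ 2.
  have [->|T_gt0] := posnP T; first by rewrite !big_geq // mulr0.
  have := key T (leqnn T); apply: le_trans.
  have W0 : W T.+1 = 0 by rewrite /W big_geq.
  rewrite W0 mul0r addr0 lerDl.
  have B_ge0 : 0 <= B.
    apply: le_trans (WS_le (n := T) _); last by rewrite T_gt0 leqnn.
    by rewrite mulr_ge0 // /W big_nat1 w_ge0.
  by rewrite mulr_ge0 // divr_ge0 ?sqr_ge0.
elim: n => [|n IH] ltnT.
  by rewrite !big_geq // F0 expr0n /= mul0r !mulr0 !addr0.
have {}IH := IH (ltnW ltnT).
rewrite big_nat_recr //= [X in _ <= 4 * B * X]big_nat_recr //=.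
set E := \sum_(1 <= k < n.+1) a k * _ in IH *.
set M := \sum_(1 <= k < n.+1) _ in IH *.
(* By this split the left side grows by [W n.+1 * (F n.+1 ^+ 2 - F n ^+ 2)] plus the change of the
   slack. *)
have WE : W n.+1 = w n.+1 + W n.+2 by rewrite /W big_ltn.
have WSB := WS_le (n := n.+1) ltnT.
have S1 := S_gt0 n.
have W_le : W n.+1 <= B / S n.+1 by rewrite ler_pdivlMr.
have B_ge0 : 0 <= B.
  apply: le_trans WSB; rewrite mulr_ge0 // /W big_nat_cond sumr_ge0 // => k.
  by rewrite andbT => /andP[_]; rewrite ltnS => /w_ge0.
(* Monotonicity of [F] allows [W n.+1] to be replaced by its upper bound. *)
have dF : 0 <= F n.+1 ^+ 2 - F n ^+ 2 by rewrite subr_ge0 lerXn2r ?nnegrE.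
have dW : W n.+1 * (F n.+1 ^+ 2 - F n ^+ 2)
    <= B * (F n.+1 ^+ 2 / S n.+1 - F n ^+ 2 / S n.+1).
  by rewrite -mulrBl mulrA mulrAC ler_wpM2r.
have step : F n.+1 ^+ 2 / S n.+1 - F n ^+ 2 / S n.+1
    + (F n.+1 ^+ 2 / S n.+1 - F n ^+ 2 / S n)
    <= 4 * (a n.+1 * (F n.+1 - F n) ^+ 2).
  have aE : a n.+1 = (S n.+1 - S n)^-1 by rewrite SS addrC addKr invrK.
  (* For [n = 0] the value [t = S 0 = 0] is excluded from [hardy_step_form]; both differences equal
     [F 1 ^+ 2 / S 1], and [2 <= 4] suffices. *)
  case: n => [|n] in S1 aE {IH ltnT E M WE WSB W_le dF dW} *.
    rewrite aE F0 /S (@big_geq _ _ _ 1 1) // expr0n /= !mul0r !subr0.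
    set z := \sum_(1 <= k < 2) _ in S1 *.
    have : 0 <= F 1%N ^+ 2 / z by rewrite divr_ge0 ?sqr_ge0 // ltW.
    by rewrite [z^-1 * _]mulrC; lra.
  rewrite aE [_^-1 * _]mulrC; apply: hardy_step_form; first exact: S_gt0.
  by rewrite (SS n.+1) ltrDl invr_gt0.
have := ler_wpM2l B_ge0 step.
move: IH dW; rewrite WE; lra.
Qed.

Theorem hardy (f : nat -> R) : f 0%N = 0 ->
  \sum_(1 <= k < T.+1) f k ^+ 2 * w k
    <= 4 * B * \sum_(1 <= k < T.+1) a k * (f k - f k.-1) ^+ 2.
Proof.
move=> f0; pose F n := \sum_(1 <= k < n.+1) `|f k - f k.-1|.
have FS n : F n.+1 = F n + `|f n.+1 - f n| by rewrite /F big_nat_recr.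
have F0 : F 0%N = 0 by rewrite /F big_geq.
have f_le n : `|f n| <= F n.
  elim: n => [|n IH]; first by rewrite f0 normr0 F0.
  rewrite FS -{1}(subrK (f n) (f n.+1)) addrC.
  by rewrite (le_trans (ler_normD _ _)) // lerD2r.
have Fnd n : F n <= F n.+1 by rewrite FS lerDl.
have := hardy_nondecreasing F0 Fnd.
have -> : \sum_(1 <= k < T.+1) a k * (F k - F k.-1) ^+ 2 =
          \sum_(1 <= k < T.+1) a k * (f k - f k.-1) ^+ 2.
  apply: eq_big_nat => -[|k] // _ /=.
  by rewrite FS [F k + _]addrC addrK real_normK ?num_real.
apply: le_trans; apply: ler_sum_nat => k /andP[_ ltkT].
rewrite ler_wpM2r ?w_ge0 // -[f k ^+ 2]real_normK ?num_real //.
by rewrite lerXn2r ?nnegrE // (le_trans _ (f_le k)).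
Qed.

End Hardy.

(** * The Rayleigh quotient and its lower bound *)

(** Each edge between [k - 1] and [k] is counted once from each endpoint; the outer edges at [0] and
    [T] contribute nothing, as [f] is constant across them. *)
Lemma energy_edge_sum (R : realType) (nu : nat -> R) (T : nat) (f : int -> R) :
  admissible T f ->
  energy nu T f = 2^-1 * \sum_(1 <= k < T.+1)
    (nu k + nu k.-1) * (f k%:Z - f k.-1%:Z) ^+ 2.
Proof.
case=> f0 _ fneg fT; congr (_ * _).
under eq_bigr do rewrite mulrDr.
rewrite big_split /= big_nat_recr //= [X in _ + X]big_nat_recl //=.
rewrite (fT (T%:Z + 1)); last by lia.
rewrite (fneg (0 - 1)) // f0 !subrr expr0n /= !mulr0 addr0 add0r -big_split /=.
rewrite big_add1 /=; apply: eq_big_nat => k _.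
have -> : k%:Z + 1 = k.+1%:Z by lia.
have -> : k.+1%:Z - 1 = k%:Z by lia.
by ring.
Qed.

Section Bounds.
Context {R : realType}.
Variables (h : R) (nu : nat -> R) (T : nat).
Hypothesis h_gt0 : 0 < h.
Hypothesis nu_gt0 : forall k, 0 < nu k.
Hypothesis T_largest : largest_cutoff h nu T.
Hypothesis T_ge1 : (1 <= T)%N.

Let a k := nu k + nu k.-1.
Let W n := \sum_(n <= k < T.+1) weight h nu k.
Let S n := \sum_(1 <= k < n.+1) (a k)^-1.

Let a_gt0 k : 0 < a k.
Proof. exact: addr_gt0. Qed.

Lemma weight_gt0 k : (k <= T)%N -> 0 < weight h nu k.
Proof.
move=> lekT; rewrite /weight subr_gt0; apply: le_lt_trans (T_largest.1).
rewrite ler_pM2l // [leRHS](big_cat_nat _ (n := k.+1)) //= lerDl.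
by rewrite sumr_ge0 // => i _; rewrite ltW.
Qed.

Let W_ge0 n : 0 <= W n.
Proof.
rewrite /W big_nat_cond sumr_ge0 // => k; rewrite andbT ltnS => /andP[_ ?].
by rewrite ltW // weight_gt0.
Qed.

Let S_ge0 n : 0 <= S n.
Proof. by apply: sumr_ge0 => k _; rewrite invr_ge0 ltW. Qed.

Let W_gt0 n : (n <= T)%N -> 0 < W n.
Proof.
move=> lenT; rewrite /W big_ltn ?ltnS // ltr_pwDl ?weight_gt0 //.
exact: (W_ge0 n.+1).
Qed.

Let S_gt0 n : (1 <= n)%N -> 0 < S n.
Proof.
by case: n => // n _; rewrite /S big_nat_recr //= ltr_wpDl ?invr_gt0 ?(S_ge0 n).
Qed.

Let S_le m n : (m <= n)%N -> S m <= S n.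
Proof.
move=> lemn; rewrite [leRHS](big_cat_nat _ (n := m.+1)) //= lerDl.
by rewrite sumr_ge0 // => k _; rewrite invr_ge0 ltW.
Qed.

Lemma muckenhoupt_le_sup n : (1 <= n)%N -> W n * S n <= muckenhoupt_sup h nu T.
Proof.
move=> n_ge1; apply: ub_le_sup; last by exists n.
(* Up to [T], [W] decreases and [S] increases; beyond [T], [W] vanishes. *)
exists (W 1 * S T) => _ [m /= m_ge1 <-].
have [lemT|ltTm] := leqP m T; last first.
  by rewrite (big_geq (m := m)) // mul0r mulr_ge0.
apply: ler_pM; rewrite ?W_ge0 ?(S_ge0 m) ?(S_le lemT) //.
rewrite /W [leRHS](big_cat_nat _ (n := m)) //=; last exact: leqW.
rewrite lerDr big_nat_cond sumr_ge0 // => k /andP[/andP[_ ltkm] _].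
by rewrite ltW // weight_gt0 // (leq_trans (ltnW ltkm)).
Qed.

Lemma muckenhoupt_sup_gt0 : 0 < muckenhoupt_sup h nu T.
Proof.
apply: lt_le_trans (muckenhoupt_le_sup (leqnn 1)).
by rewrite mulr_gt0 ?W_gt0 ?S_gt0.
Qed.

Lemma mass_gt0 f : admissible T f -> 0 < mass h nu T f.
Proof.
case=> _ f1 _ _; rewrite /mass big_ltn // ltr_pwDl //.
  by rewrite mulr_gt0 ?weight_gt0 // exprn_even_gt0.
rewrite big_nat_cond sumr_ge0 // => k; rewrite andbT ltnS => /andP[_ ?].
by rewrite mulr_ge0 ?sqr_ge0 // ltW // weight_gt0.
Qed.

(** The 8 is the Hardy constant 4 times the 2 from the factor [2^-1] in the energy. *)
Lemma rayleigh_quotient_ge f : admissible T f ->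
  1 / (8 * muckenhoupt_sup h nu T) <= energy nu T f / mass h nu T f.
Proof.
move=> fadm; have B_gt0 := muckenhoupt_sup_gt0.
have w_ge0 k : (k <= T)%N -> 0 <= weight h nu k by move/weight_gt0/ltW.
have WS n : (1 <= n <= T)%N -> W n * S n <= muckenhoupt_sup h nu T.
  by case/andP=> ? _; apply: muckenhoupt_le_sup.
have f0 : f 0%N%:Z = 0 by case: fadm.
have := hardy w_ge0 a_gt0 WS (f := fun k => f k%:Z) f0.
rewrite -/(mass h nu T f) => massE.
rewrite ler_pdivlMr ?mass_gt0 // mulrAC mul1r ler_pdivrMr; last by lra.
by rewrite energy_edge_sum //; move: massE; lra.
Qed.

(** * Trial functions and the bounds on the infimum *)

(** The increments [(a k)^-1] up to [n] are the equality case of Cauchy-Schwarz: they minimise the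
    energy for the given value at [n]. *)
Definition trial (n : nat) (i : int) : R :=
  if i is Posz k then S (minn k n) else 0.

Lemma trial_admissible n : (1 <= n <= T)%N -> admissible T (trial n).
Proof.
case/andP=> n_ge1 lenT; split => //=.
- by rewrite min0n /S big_geq.
- by rewrite (minn_idPl n_ge1) gt_eqF // S_gt0.
- by case.
- case=> //= k; rewrite ltz_nat => ltTk.
  by rewrite !(minn_idPr _) // (leq_trans lenT (ltnW ltTk)).
Qed.

Lemma energy_trial n : (1 <= n <= T)%N -> energy nu T (trial n) = S n / 2.
Proof.
move=> nT; rewrite (energy_edge_sum _ (trial_admissible nT)) mulrC.
congr (_ / _).
have /andP[_ lenT] := nT.
rewrite (big_cat_nat _ (n := n.+1)) //= [X in _ + X]big_nat_cond.
rewrite [X in _ + X]big1 ?addr0.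
  apply: eq_big_nat => -[|k] // /andP[_ lekn] /=.
  rewrite !(minn_idPl _) //; last exact: ltnW.
  have -> : S k.+1 - S k = (a k.+1)^-1.
    by rewrite /S [X in X - _]big_nat_recr //= addrAC subrr add0r.
  rewrite expr2 mulrA divff ?mul1r //.
  by rewrite gt_eqF // a_gt0.
move=> [|k] //; rewrite andbT => /andP[ltnk _] /=.
by rewrite !(minn_idPr _) ?subrr ?expr0n ?mulr0 // ltnW.
Qed.

Lemma mass_trial n : (1 <= n <= T)%N -> S n ^+ 2 * W n <= mass h nu T (trial n).
Proof.
case/andP=> n_ge1 lenT.
rewrite /mass (big_cat_nat _ (n := n)) //=; last exact: leqW.
rewrite mulr_sumr.
have -> : \sum_(n <= k < T.+1) S n ^+ 2 * weight h nu k =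
    \sum_(n <= k < T.+1) S (minn k n) ^+ 2 * weight h nu k.
  by apply: eq_big_nat => k /andP[lenk _]; rewrite (minn_idPr lenk).
rewrite lerDr big_nat_cond sumr_ge0 // => k /andP[/andP[_ ltkn] _].
by rewrite mulr_ge0 ?sqr_ge0 // ltW // weight_gt0 // (leq_trans (ltnW ltkn)).
Qed.

Lemma rayleigh_inf_ge : 1 / (8 * muckenhoupt_sup h nu T) <= rayleigh_inf h nu T.
Proof.
apply: lb_le_inf.
  by eexists; exists (trial 1); first exact: trial_admissible.
by move=> _ [f fadm <-]; apply: rayleigh_quotient_ge.
Qed.

Lemma rayleigh_inf_le_term n : (1 <= n <= T)%N ->
  rayleigh_inf h nu T * (2 * (W n * S n)) <= 1.
Proof.
move=> nT; have /andP[n_ge1 lenT] := nT.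
have Sn := S_gt0 n_ge1; have Wn := W_gt0 lenT.
rewrite -ler_pdivlMr ?mulr_gt0 //.
apply: (@le_trans _ _ (energy nu T (trial n) / mass h nu T (trial n))).
  apply: ge_inf; last by exists (trial n) => //; apply: trial_admissible.
  (* An infimum lies below its members only if the set is bounded below; the Hardy bound provides
     this. *)
  exists (1 / (8 * muckenhoupt_sup h nu T)) => _ [f fadm <-].
  exact: rayleigh_quotient_ge.
rewrite ler_pdivrMr ?(mass_gt0 (trial_admissible nT)) // energy_trial //.
rewrite mul1r [leRHS]mulrC ler_pdivlMr ?mulr_gt0 //.
have -> : S n / 2 * (2 * (W n * S n)) = S n ^+ 2 * W n by field.
exact: mass_trial.
Qed.

Lemma rayleigh_inf_le : rayleigh_inf h nu T <= 1 / (2 * muckenhoupt_sup h nu T).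
Proof.
have B_gt0 := muckenhoupt_sup_gt0.
(* Positivity of the infimum turns the claim into an upper bound on the supremum, checked term by
   term. *)
have R_gt0 : 0 < rayleigh_inf h nu T.
  by apply: lt_le_trans rayleigh_inf_ge; rewrite divr_gt0 // mulr_gt0.
rewrite ler_pdivlMr ?mulr_gt0 // mulrA -ler_pdivlMl ?mulr_gt0 // mulr1.
apply: ge_sup; first by eexists; exists 1%N.
move=> _ [n /= n_ge1 <-]; have [lenT|ltTn] := leqP n T; last first.
  by rewrite (big_geq (m := n)) // mul0r invr_ge0 mulr_ge0 // ltW.
rewrite -[leRHS]mulr1 ler_pdivlMl ?mulr_gt0 // -mulrA.
by apply: rayleigh_inf_le_term; rewrite n_ge1.
Qed.

End Bounds.

Theorem theorem5p10 (R : realType) (h : R) (nu : nat -> R) (T : nat)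
  (h_gt0 : 0 < h)
  (nu_gt0 : forall k, 0 < nu k)
  (nu0_ge1 : 1 <= nu 0%N)
  (T_largest : largest_cutoff h nu T)
  (T_ge1 : (1 <= T)%N) :
  1 / (8 * muckenhoupt_sup h nu T) <= rayleigh_inf h nu T
  /\ rayleigh_inf h nu T <= 1 / (2 * muckenhoupt_sup h nu T).
Proof. by split; [apply: rayleigh_inf_ge | apply: rayleigh_inf_le]. Qed.
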